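(* Let $M$ be an $n$-dimensional differentiable manifold, $n\ge2$, and $A:\mathfrak{X}(M)\to\mathfrak{X}(M)$ a nilcyclic $(1,1)$ tensor on $M$. Then the condition $$\tau^{(n-1)}_A(X,Y)=0\qquad\text{for all vector fields }X,Y$$ is necessary for the existence of a local chart in which $A$ takes the triangular form $$A=\sum_{i,j=1}^n a^i_j(x)\,\frac{\partial}{\partial x^i}\otimes dx^j,\qquad a^i_j=0\ \text{ if } i\ge j,$$ with $a^i_j$ smooth functions; that is, if $A$ has this form in a chart with domain $U$, then $\tau^{(n-1)}_A=0$ on $U$.
   Context: $\mathfrak{X}(M)$ denotes the smooth vector fields on $M$, $[\cdot,\cdot]$ the Lie bracket; operators are smooth $(1,1)$ tensor fields. $A$ is nilcyclic if it is nilpotent of maximal index $n$: $A^n=0$ and $A^{n-1}\neq0$, so that there exist local reference frames (possibly non-integrable) in which $A$ is represented by a single strictly upper triangular Jordan block, and $\operatorname{rank}(\ker A^j)=j$ for $j=1,\dots,n$. Generalized Nijenhuis torsions: $\tau^{(0)}_A(X,Y):=[X,Y]$ and, for $m\ge1$, $$\tau^{(m)}_A(X,Y):=A^2\tau^{(m-1)}_A(X,Y)+\tau^{(m-1)}_A(AX,AY)-A\big(\tau^{(m-1)}_A(X,AY)+\tau^{(m-1)}_A(AX,Y)\big).$$ *)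

(* Defs.v *)
From mathcomp Require Import all_boot all_order all_algebra.
From mathcomp Require Import all_classical all_reals all_analysis.

Set Implicit Arguments.
Unset Strict Implicit.
Unset Printing Implicit Defensive.

Import Order.TTheory GRing.Theory Num.Theory.
Import numFieldNormedType.Exports.

Local Open Scope classical_set_scope.
Local Open Scope ring_scope.

(* O is meant to be open; for k.+1 the function is differentiable at every
   point of O and all its first partial derivatives are of class C^k on O. *)
Fixpoint Ck_on (R : realType) (n : nat) (V : normedModType R) (k : nat)
    (O : set 'cV[R]_n) (f : 'cV[R]_n -> V) : Prop :=
  if k is k'.+1 then
    (forall x, O x -> differentiable f x) /\
    (forall i : 'I_n, Ck_on k' O (fun x => 'D_(delta_mx i 0) f x))
  else forall x, O x -> {for x, continuous f}.

Definition smooth_on (R : realType) (n : nat) (V : normedModType R)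
    (O : set 'cV[R]_n) (f : 'cV[R]_n -> V) : Prop :=
  forall k, Ck_on k O f.

(* A chart (U, x): a homeomorphism from an open set U of M onto an open set of
   R^n.  Both directions are total functions, with arbitrary values outside U
   and outside the image of U respectively. *)
Record chart (R : realType) (n : nat) (M : topologicalType) := Chart {
  chart_dom : set M;
  chart_map :> M -> 'cV[R]_n;
  chart_inv : 'cV[R]_n -> M;
  chart_dom_open : open chart_dom;
  chart_img_open : open (chart_map @` chart_dom);
  chart_mapK : forall p, chart_dom p -> chart_inv (chart_map p) = p;
  chart_map_continuous :
    forall p, chart_dom p -> {for p, continuous chart_map};
  chart_inv_continuous :
    forall x, (chart_map @` chart_dom) x -> {for x, continuous chart_inv}
}.

Definition transition (R : realType) (n : nat) (M : topologicalType)
    (c d : chart R n M) : 'cV[R]_n -> 'cV[R]_n :=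
  fun x => d (chart_inv c x).

Definition compatible (R : realType) (n : nat) (M : topologicalType)
    (c d : chart R n M) : Prop :=
  smooth_on (c @` (chart_dom c `&` chart_dom d)) (transition c d) /\
  smooth_on (d @` (chart_dom c `&` chart_dom d)) (transition d c).

(* The atlas is maximal, so its members are all the charts of the smooth
   structure. *)
Record manifold (R : realType) (n : nat) := Manifold {
  carrier :> topologicalType;
  carrier_hausdorff : hausdorff_space carrier;
  carrier_second_countable : @second_countable carrier;
  atlas : set (chart R n carrier);
  atlas_cover : forall p : carrier, exists2 c, atlas c & chart_dom c p;
  atlas_compatible : forall c d, atlas c -> atlas d -> compatible c d;
  atlas_maximal :
    forall c, (forall d, atlas d -> compatible c d) -> atlas c
}.

(* Component families: X c p is the column of the components X^i(p) in the
   frame d/dx^i of the chart c, and A c p is the matrix of the components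
   a^i_j(p) in the frame d/dx^i (x) dx^j.  They are meaningful only for c in
   the atlas and p in the domain of c. *)
Definition vcomp (R : realType) (n : nat) (M : manifold R n) : Type :=
  chart R n M -> M -> 'cV[R]_n.

Definition tcomp (R : realType) (n : nat) (M : manifold R n) : Type :=
  chart R n M -> M -> 'M[R]_n.

(* Smooth vector fields on the open set W.  The first law is
   X_d^i = sum_j (dy^i / dx^j) X_c^j, for coordinates x of c and y of d: the
   Jacobian of the change of coordinates is applied to the components. *)
Record vector_field (R : realType) (n : nat) (M : manifold R n)
    (W : set M) := VectorField {
  vf_comp :> vcomp M;
  vf_transform : forall c d, atlas c -> atlas d ->
    forall p, W p -> chart_dom c p -> chart_dom d p ->
    vf_comp d p = 'D_(vf_comp c p) (transition c d) (c p);
  vf_smooth : forall c, atlas c ->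
    smooth_on (c @` (W `&` chart_dom c)) (fun x => vf_comp c (chart_inv c x))
}.

(* Smooth (1,1) tensor fields.  The first law is A_d J = J A_c, where J is the
   Jacobian of the change of coordinates from c to d. *)
Record tensor11 (R : realType) (n : nat) (M : manifold R n) := Tensor11 {
  t11_comp :> tcomp M;
  t11_transform : forall c d, atlas c -> atlas d ->
    forall p, chart_dom c p -> chart_dom d p -> forall v : 'cV[R]_n,
    t11_comp d p *m 'D_v (transition c d) (c p) =
    'D_(t11_comp c p *m v) (transition c d) (c p);
  t11_smooth : forall c, atlas c ->
    smooth_on (c @` chart_dom c) (fun x => t11_comp c (chart_inv c x))
}.

Definition t11_act (R : realType) (n : nat) (M : manifold R n)
    (A : tcomp M) (X : vcomp M) : vcomp M :=
  fun c p => A c p *m X c p.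

(* [X, Y]^i = sum_j (X^j dY^i/dx^j - Y^j dX^i/dx^j). *)
Definition lie_bracket (R : realType) (n : nat) (M : manifold R n)
    (X Y : vcomp M) : vcomp M :=
  fun c p =>
    'D_(X c p) (fun x => Y c (chart_inv c x)) (c p) -
    'D_(Y c p) (fun x => X c (chart_inv c x)) (c p).

Fixpoint nijenhuis_torsion (R : realType) (n : nat) (M : manifold R n)
    (A : tcomp M) (m : nat) (X Y : vcomp M) : vcomp M :=
  if m is m'.+1 then
    let tau := nijenhuis_torsion A m' in
    fun c p =>
      t11_act A (t11_act A (tau X Y)) c p
      + tau (t11_act A X) (t11_act A Y) c p
      - t11_act A (fun c' p' => tau X (t11_act A Y) c' p'
                                + tau (t11_act A X) Y c' p') c p
  else lie_bracket X Y.

(* The tangent vector at p is zero: its components vanish in every chart. *)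
Definition vanishes_at (R : realType) (n : nat) (M : manifold R n)
    (Z : vcomp M) (p : M) : Prop :=
  forall c, atlas c -> chart_dom c p -> Z c p = 0.

(* A^n = 0 and A^(n-1) <> 0 at every point of M. *)
Definition nilcyclic (R : realType) (n : nat) (M : manifold R n)
    (A : tensor11 M) : Prop :=
  forall c p, atlas c -> chart_dom c p ->
    t11_comp A c p ^+ n = 0 /\ t11_comp A c p ^+ n.-1 != 0.

(* On the domain of c, A = sum_(i, j) a^i_j(x) d/dx^i (x) dx^j with a^i_j
   smooth and a^i_j = 0 for i >= j; delta_mx i j is the matrix of
   d/dx^i (x) dx^j in the chart c. *)
Definition triangular_in (R : realType) (n : nat) (M : manifold R n)
    (A : tensor11 M) (c : chart R n M) : Prop :=
  exists a : 'I_n -> 'I_n -> 'cV[R]_n -> R,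
  [/\ forall i j, smooth_on (c @` chart_dom c) (a i j : 'cV[R]_n -> R^o),
      forall i j : 'I_n, (j <= i)%N ->
        forall p, chart_dom c p -> a i j (c p) = 0 &
      forall p, chart_dom c p ->
        t11_comp A c p = \sum_(i < n) \sum_(j < n) a i j (c p) *: delta_mx i j].

(* Main.v *)
Require Import Defs.
From mathcomp Require Import all_boot all_order all_algebra.
From mathcomp Require Import all_classical all_reals all_analysis.
From mathcomp Require Import ring lra zify.
Set Implicit Arguments.
Unset Strict Implicit.
Unset Printing Implicit Defensive.
Import Order.TTheory GRing.Theory Num.Theory.
Import numFieldNormedType.Exports.
Local Open Scope classical_set_scope.
Local Open Scope ring_scope.

(** Two independent facts give the theorem.

    The torsions are tensorial in the weak sense that their components change
    by the Jacobian J of the change of coordinates ([torsion_related]).  The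
    recursion only applies A and takes brackets of the fields A^k X and A^l Y,
    so everything reduces to the invariance of the Lie bracket
    ([bracket_related]), that is, to the symmetry of second derivatives
    ([derive_sym]).  Hence it is enough to find zero in the chart where A is
    triangular.

    In that chart, write tau^(m)(X, Y) = Phi_m(X, Y) - Phi_m(Y, X), where
    Phi_0(X, Y) = D_X Y and where each step of the recursion applies to Phi the
    two commuting operations
      beta |-> beta(A X, Y) - A beta(X, Y),
      beta |-> beta(X, A Y) - A beta(X, Y).
    After one step the derivatives of X and Y have disappeared and
    Phi_1(X, Y) = (D_{AX} A) Y - A (D_X A) Y, so that Phi_m is from then on an
    algebraic expression in the vectors X(x) and Y(x).  Say that a
    matrix has level k when its (i, j) entries with j < i + k vanish ([band]): A
    and its derivatives have level 1, levels add up in products, and by induction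
      Phi_m(X, Y) = g_m(A^m X) Y + r_m(X) Y
    with g_m(u) homogeneous in u, of level m, and r_m(u) of level m + 1
    ([torsion_normal_form]).  For m = n - 1 this leaves nothing of r, and a
    matrix of level n - 1 has a single possibly nonzero entry, in the upper
    right corner.  Both A^(n-1) and g(e_1) are of this shape, so Phi_(n-1)(X, Y)
    is a multiple of X^n Y^n e_1: it is symmetric in X and Y, and tau^(n-1)
    vanishes ([triangular_torsion_eq0]). *)

(** * Calculus of matrix-valued functions *)

Lemma differentiable_mx (R : realType) (U : normedModType R) (m n : nat)
    (M : U -> 'M[R]_(m, n)) (x : U) :
  (forall i j, differentiable (fun y => M y i j) x) -> differentiable M x.
Proof.
move=> dM.
have -> : M = \sum_(i < m) \sum_(j < n) (fun y => M y i j *: delta_mx i j).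
  apply/funext => y; rewrite fct_sumE [LHS]matrix_sum_delta.
  by apply: eq_bigr => i _; rewrite fct_sumE.
by do 2![apply: differentiable_sum => ?]; exact: differentiableZl.
Qed.

Lemma differentiable_entry (R : realType) (U : normedModType R) (m n : nat)
    (M : U -> 'M[R]_(m, n)) (x : U) i j :
  differentiable M x -> differentiable (fun y => M y i j) x.
Proof.
move=> dM; apply: (differentiable_comp (g := fun N : 'M[R]_(m, n) => N i j)).
  exact: dM.
exact: differentiable_coord.
Qed.

Lemma differentiable_mulmx (R : realType) (U : normedModType R) (m n p : nat)
    (M : U -> 'M[R]_(m, n)) (N : U -> 'M[R]_(n, p)) (x : U) :
  differentiable M x -> differentiable N x ->
  differentiable (fun y => M y *m N y) x.
Proof.
move=> dM dN; apply: differentiable_mx => i j.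
have -> : (fun y => (M y *m N y) i j) =
          \sum_(k < n) ((fun y => M y i k) * (fun y => N y k j)).
  by apply/funext => y; rewrite mxE fct_sumE; apply: eq_bigr.
apply: differentiable_sum => k.
by apply: differentiableM; exact: differentiable_entry.
Qed.

Lemma derive_mulmx (R : realType) (U : normedModType R) (m n p : nat)
    (M : U -> 'M[R]_(m, n)) (N : U -> 'M[R]_(n, p)) (x v : U) :
  differentiable M x -> differentiable N x ->
  'D_v (fun y => M y *m N y) x = 'D_v M x *m N x + M x *m 'D_v N x.
Proof.
move=> dM dN.
have dMN := differentiable_mulmx dM dN.
rewrite !derive_mx; do ?exact: diff_derivable.
apply/matrixP => i j; rewrite !mxE.
have -> : (fun y => (M y *m N y) i j) =
          \sum_(k < n) ((fun y => M y i k) * (fun y => N y k j)).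
  by apply/funext => y; rewrite mxE fct_sumE; apply: eq_bigr.
have dMe k : derivable (fun y => M y i k) x v.
  exact/diff_derivable/differentiable_entry.
have dNe k : derivable (fun y => N y k j) x v.
  exact/diff_derivable/differentiable_entry.
rewrite derive_sum; last by move=> k; exact: derivableM.
rewrite -big_split; apply: eq_bigr => k _ /=.
by rewrite deriveM// !mxE addrC; congr (_ + _); exact: mulrC.
Qed.

Lemma derive_entry (R : realType) (U : normedModType R) (m n : nat)
    (M : U -> 'M[R]_(m, n)) (x v : U) i j :
  differentiable M x -> ('D_v M x) i j = 'D_v (fun y => M y i j) x.
Proof. by move=> dM; rewrite derive_mx ?mxE//; exact: diff_derivable. Qed.

(** * Symmetry of second derivatives *)

Lemma is_derive_line (R : realType) (U : normedModType R) (f : U -> R)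
    (x u : U) (s d : R) :
  is_derive (x + s *: u) u f d -> is_derive s 1 (fun a => f (x + a *: u)) d.
Proof.
have quotE : (fun h : R => h^-1 *: (((fun a : R => f (x + a *: u)) \o shift s)
      (h *: 1) - f (x + s *: u))) =
    (fun h => h^-1 *: ((f \o shift (x + s *: u)) (h *: u) - f (x + s *: u))).
  apply/funext => h; congr (_ *: (f _ - _)).
  by rewrite /= [h *: 1]mulr1 scalerDl addrCA.
by move=> [df <-]; apply: DeriveDef; rewrite /derivable /derive quotE.
Qed.

(** The mean value theorem along u turns the second difference of f over the
    parallelogram (t u, t v) into t times the increment of the derivative G of f
    along u over t v, and the differentiability of G at the single point x
    evaluates that increment up to o(t). *)
Lemma second_difference (R : realType) (U : normedModType R) (f G : U -> R)
    (x u v : U) :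
  (\forall y \near x, is_derive y u f (G y)) -> differentiable G x ->
  forall e : R, 0 < e -> \forall t \near 0^'+,
    `|f (x + t *: u + t *: v) - f (x + t *: u) - (f (x + t *: v) - f x)
      - t ^+ 2 * 'D_v G x| <= e * t ^+ 2.
Proof.
move=> df dG e e0.
(* t * c bounds the norm of both corners s u and t v + s u, for 0 <= s <= t;
   the summand 1 keeps c positive when u = v = 0 *)
pose c := `|u| + `|v| + 1.
have c0 : 0 < c by rewrite /c ltr_wpDl// addr_ge0.
pose e' := e / (2 * c).
have e'0 : 0 < e' by rewrite divr_gt0// mulr_gt0.
have near_dG : \forall h \near (0 : U),
    `|G (x + h) - G x - 'd G x h| <= e' * `|h|.
  have Go : (fun h => G (x + h)) = (fun h => G x + 'd G x h) +o_ (0 : U) id.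
    apply/funext => h; exact: diff_locallyxC.
  move/eqaddoP : Go => /(_ _ e'0); apply: filterS => h /=.
  by rewrite !fctE opprD addrA.
have [r r0 near_xr] : exists2 r : R, 0 < r & forall h : U, `|h| < r ->
    is_derive (x + h) u f (G (x + h)) /\ `|G (x + h) - G x - 'd G x h| <= e' * `|h|.
  move: near_dG df => /nbhs_normP [r2 /= r20 h2] /nbhs_normP [r1 /= r10 h1].
  exists (Num.min r1 r2); first by rewrite lt_min r10.
  move=> h; rewrite lt_min => /andP[hr1 hr2].
  by split; [apply: h1; rewrite /= opprD addNKr|apply: h2; rewrite /= sub0r];
    rewrite normrN.
near=> t.
have t0 : 0 < t by near: t; exact: nbhs_right_gt.
have tr : t * c < r.
  rewrite -ltr_pdivlMr//; near: t; apply: nbhs_right_lt; exact: divr_gt0.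
have small s : 0 <= s <= t -> `|s *: u| <= t * c.
  move=> /andP[s0 st]; rewrite normrZ ger0_norm// ler_pM//.
  by rewrite /c -addrA lerDl addr_ge0.
have small2 s : 0 <= s <= t -> `|t *: v + s *: u| <= t * c.
  move=> /andP[s0 st]; rewrite (le_trans (ler_normD _ _))// !normrZ.
  rewrite (ger0_norm s0) (ger0_norm (ltW t0)).
  have := ler_wpM2r (normr_ge0 u) st.
  by rewrite /c; lra.
pose phi (s : R) : R := f (x + t *: v + s *: u) - f (x + s *: u).
pose dphi (s : R) : R := G (x + t *: v + s *: u) - G (x + s *: u).
have phi_der : forall s, 0 <= s <= t -> is_derive s 1 phi (dphi s).
  move=> s st; apply: is_deriveB; apply: is_derive_line.
    by rewrite -addrA; have [] := near_xr _ (le_lt_trans (small2 s st) tr).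
  by have [] := near_xr _ (le_lt_trans (small s st) tr).
have [s s_in phiE] : exists2 s, s \in `]0, t[%R & phi t - phi 0 = dphi s * (t - 0).
  apply: MVT => //.
    by move=> a /[!in_itv]/= /andP[a0 at_]; apply: phi_der; rewrite !ltW.
  apply: derivable_within_continuous => a /[!in_itv]/= at_.
  by have [] := phi_der a at_.
have st : 0 <= s <= t by move: s_in; rewrite in_itv/= => /andP[? ?]; rewrite !ltW.
have [_ G1] := near_xr _ (le_lt_trans (small2 s st) tr).
have [_ G2] := near_xr _ (le_lt_trans (small s st) tr).
have -> : f (x + t *: u + t *: v) - f (x + t *: u) - (f (x + t *: v) - f x) =
    phi t - phi 0.
  by rewrite /phi !scale0r !addr0 [x + t *: v + _]addrAC.
rewrite phiE subr0 deriveE//.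
have -> : dphi s * t - t ^+ 2 * 'd G x v = t * (
    (G (x + (t *: v + s *: u)) - G x - 'd G x (t *: v + s *: u)) -
    (G (x + s *: u) - G x - 'd G x (s *: u))).
  have dGt : 'd G x (t *: v) = t * 'd G x v by exact: linearZ.
  by rewrite linearD dGt /dphi (addrA x); ring.
rewrite normrM (gtr0_norm t0) expr2 mulrCA.
apply: ler_wpM2l; first exact: ltW.
rewrite (le_trans (ler_normB _ _))// (le_trans (lerD G1 G2))//.
have -> : e * t = e' * (t * c) + e' * (t * c).
  by rewrite /e'; field; rewrite gt_eqF.
by apply: lerD; apply: ler_wpM2l; rewrite ?(ltW e'0) ?small ?small2.
Unshelve. all: by end_near. Qed.

(** The second difference is symmetric in u and v.  The derivatives Fu and Fv
    are only compared with f near x, so that they may be given by formulas valid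
    on an open set. *)
Lemma derive_sym (R : realType) (U : normedModType R) (f Fu Fv : U -> R)
    (x u v : U) :
  (\forall y \near x, is_derive y u f (Fu y)) ->
  (\forall y \near x, is_derive y v f (Fv y)) ->
  differentiable Fu x -> differentiable Fv x -> 'D_v Fu x = 'D_u Fv x.
Proof.
move=> fu fv du dv; apply/eqP; rewrite -subr_eq0 -normr_le0.
apply/ler_addgt0Pr => e e0; rewrite add0r.
have e20 : 0 < e / 2 by rewrite divr_gt0.
have uv := second_difference v fu du e20.
have vu := second_difference u fv dv e20.
near (at_right (0 : R)) => t.
have t0 : 0 < t by near: t; exact: nbhs_right_gt.
have t20 : 0 < t ^+ 2 by rewrite exprn_gt0.
rewrite -(ler_pM2l t20) -[X in X * `|_|](gtr0_norm t20) -normrM.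
have uvt : `|f (x + t *: u + t *: v) - f (x + t *: u) - (f (x + t *: v) - f x)
      - t ^+ 2 * 'D_v Fu x| <= e / 2 * t ^+ 2 by near: t.
have vut : `|f (x + t *: v + t *: u) - f (x + t *: v) - (f (x + t *: u) - f x)
      - t ^+ 2 * 'D_u Fv x| <= e / 2 * t ^+ 2 by near: t.
rewrite [t ^+ 2 * e](_ : _ = e / 2 * t ^+ 2 + e / 2 * t ^+ 2); last by field.
apply: le_trans (lerD vut uvt); apply: le_trans (ler_normB _ _).
rewrite [x + t *: v + _]addrAC le_eqVlt; apply/orP; left; apply/eqP.
by congr `|_|; ring.
Unshelve. all: by end_near. Qed.

(** * Behaviour under a change of coordinates *)

Definition jac (R : realType) (n : nat) (T : 'cV[R]_n -> 'cV[R]_n)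
    (x : 'cV[R]_n) : 'M[R]_n :=
  \matrix_(i, j) ('D_(delta_mx j 0) T x) i 0.

Lemma derive_partials (R : realType) (n : nat) (V : normedModType R)
    (f : 'cV[R]_n -> V) (x v : 'cV[R]_n) :
  differentiable f x ->
  'D_v f x = \sum_(j < n) v j 0 *: 'D_(delta_mx j 0) f x.
Proof.
move=> df; rewrite deriveE// [v in LHS]matrix_sum_delta linear_sum.
by apply: eq_bigr => j _; rewrite big_ord1 linearZ deriveE.
Qed.

Lemma derive_jac (R : realType) (n : nat) (T : 'cV[R]_n -> 'cV[R]_n)
    (x v : 'cV[R]_n) :
  differentiable T x -> 'D_v T x = jac T x *m v.
Proof.
move=> dT; rewrite derive_partials//; apply/colP => i.
by rewrite summxE !mxE; apply: eq_bigr => j _; rewrite !mxE mulrC.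
Qed.

Lemma jac_differentiable (R : realType) (n : nat) (O : set 'cV[R]_n)
    (T : 'cV[R]_n -> 'cV[R]_n) (x : 'cV[R]_n) :
  Ck_on 2 O T -> O x -> differentiable (jac T) x.
Proof.
move=> [_ dpT] Ox; apply: differentiable_mx => i j.
rewrite (_ : (fun y => jac T y i j) =
             fun y => ('D_(delta_mx j 0) T y) i 0); last first.
  by apply/funext => y; rewrite mxE.
by apply: differentiable_entry; have [dTj _] := dpT j; exact: dTj.
Qed.

(** The second derivative of T, applied to u and v, is symmetric: this is where
    the equality of mixed partial derivatives enters the geometry. *)
Lemma jac_derive_sym (R : realType) (n : nat) (O : set 'cV[R]_n)
    (T : 'cV[R]_n -> 'cV[R]_n) (x u v : 'cV[R]_n) :
  open O -> Ck_on 2 O T -> O x ->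
  'D_u (jac T) x *m v = 'D_v (jac T) x *m u.
Proof.
move=> oO C2T Ox; have dJ := jac_differentiable C2T Ox.
have dJe i j := differentiable_entry i j dJ.
have nearO : \forall y \near x, O y by exact: open_nbhs_nbhs.
have partial i j : \forall y \near x,
    is_derive y (delta_mx j 0) (fun z => T z i 0) (jac T y i j).
  near=> y; have Oy : O y by near: y.
  have dTy : differentiable T y by have [dT _] := C2T; exact: dT.
  apply: DeriveDef; first exact/diff_derivable/differentiable_entry.
  by rewrite -derive_entry// mxE.
apply/colP => i; rewrite !mxE.
have expand w w' : \sum_j ('D_w (jac T) x) i j * w' j 0 = \sum_j \sum_k
    w k 0 * w' j 0 * 'D_(delta_mx k 0) (fun y => jac T y i j) x.
  apply: eq_bigr => j _; rewrite derive_entry// derive_partials// mulr_suml.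
  by apply: eq_bigr => k _; rewrite [LHS]mulrAC.
rewrite !expand exchange_big; apply: eq_bigr => k _; apply: eq_bigr => j _.
rewrite [v j 0 * _]mulrC; congr (_ * _).
exact: derive_sym (partial i j) (partial i k) (dJe i j) (dJe i k).
Unshelve. all: by end_near. Qed.

Definition bracket (R : realType) (n : nat) (X Y : 'cV[R]_n -> 'cV[R]_n)
    (x : 'cV[R]_n) : 'cV[R]_n :=
  'D_(X x) Y x - 'D_(Y x) X x.

(** The torsion in coordinates: A is a matrix-valued function and X, Y are
    vector-valued ones.  Their values outside the image of a chart are
    arbitrary, so every statement is made at a point or on an open set. *)
Fixpoint torsion (R : realType) (n : nat) (A : 'cV[R]_n -> 'M[R]_n) (m : nat)
    (X Y : 'cV[R]_n -> 'cV[R]_n) (x : 'cV[R]_n) : 'cV[R]_n :=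
  if m is m'.+1 then
    let AX y := A y *m X y in let AY y := A y *m Y y in
    A x *m (A x *m torsion A m' X Y x) + torsion A m' AX AY x
    - A x *m (torsion A m' X AY x + torsion A m' AX Y x)
  else bracket X Y x.

(** X and X' are the components of one vector field in two charts with
    transition map T.  Only first-order differentiability is recorded, which
    makes the class stable under the action of A. *)
Record related (R : realType) (n : nat) (O : set 'cV[R]_n)
    (T X X' : 'cV[R]_n -> 'cV[R]_n) : Prop := Related {
  related_source : forall x, O x -> differentiable X x;
  related_target : forall x, O x -> differentiable X' (T x);
  relatedE : forall x, O x -> X' (T x) = 'D_(X x) T x
}.

Lemma derive_related (R : realType) (n : nat) (O : set 'cV[R]_n)
    (T X X' Y Y' : 'cV[R]_n -> 'cV[R]_n) (x : 'cV[R]_n) :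
  open O -> Ck_on 2 O T -> related O T X X' -> related O T Y Y' -> O x ->
  'D_(X' (T x)) Y' (T x) =
  'D_(X x) (jac T) x *m Y x + jac T x *m 'D_(X x) Y x.
Proof.
move=> oO C2T rX rY Ox; have [dT _] := C2T.
have dY' := related_target rY Ox; have dTx := dT x Ox.
rewrite (relatedE rX)// deriveE// (deriveE _ dTx).
rewrite -[LHS]/(('d Y' (T x) \o 'd T x) (X x)) -diff_comp// -deriveE; last first.
  exact: differentiable_comp.
have dJ := jac_differentiable C2T Ox; have dY := related_source rY Ox.
rewrite -(derive_mulmx _ dJ dY).
apply: near_eq_derive; near=> y; have Oy : O y by near: y; exact: open_nbhs_nbhs.
by rewrite /= (relatedE rY)// derive_jac//; exact: dT.
Unshelve. all: by end_near. Qed.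

(** Differentiating Y' o T = J Y along X produces D_X J Y besides J (D_X Y); the
    extra terms cancel in the bracket because D_X J Y = D_Y J X. *)
Lemma bracket_related (R : realType) (n : nat) (O : set 'cV[R]_n)
    (T X X' Y Y' : 'cV[R]_n -> 'cV[R]_n) (x : 'cV[R]_n) :
  open O -> Ck_on 2 O T -> related O T X X' -> related O T Y Y' -> O x ->
  bracket X' Y' (T x) = 'D_(bracket X Y x) T x.
Proof.
move=> oO C2T rX rY Ox; have [dT _] := C2T.
rewrite /bracket (derive_related oO C2T rX rY Ox) (derive_related oO C2T rY rX Ox).
rewrite (derive_jac _ (dT x Ox)).
have cancel (J : 'M[R]_n) (a b u v : 'cV[R]_n) : a = b ->
    a + J *m u - (b + J *m v) = J *m (u - v).
  by move=> ->; rewrite opprD addrACA subrr add0r mulmxBr.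
exact/cancel/(jac_derive_sym _ _ oO C2T Ox).
Qed.

(** The recursion applies only A, which maps related fields to related fields,
    linear combinations, which commute with the Jacobian, and in the end the
    bracket. *)
Lemma torsion_related (R : realType) (n : nat) (O : set 'cV[R]_n)
    (T : 'cV[R]_n -> 'cV[R]_n) (A A' : 'cV[R]_n -> 'M[R]_n) :
  open O -> Ck_on 2 O T ->
  (forall x, O x -> differentiable A x) ->
  (forall x, O x -> differentiable A' (T x)) ->
  (forall x, O x -> forall v, A' (T x) *m 'D_v T x = 'D_(A x *m v) T x) ->
  forall m X X' Y Y', related O T X X' -> related O T Y Y' ->
  forall x, O x -> torsion A' m X' Y' (T x) = 'D_(torsion A m X Y x) T x.
Proof.
move=> oO C2T dA dA' AA'; have [dT _] := C2T.
have related_act X X' : related O T X X' ->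
    related O T (fun y => A y *m X y) (fun y => A' y *m X' y).
  move=> rX; split=> x Ox; last by rewrite (relatedE rX)// AA'.
    exact: (differentiable_mulmx (dA x Ox) (related_source rX Ox)).
  exact: (differentiable_mulmx (dA' x Ox) (related_target rX Ox)).
elim=> [|m IHm] X X' Y Y' rX rY x Ox /=; first exact: bracket_related Ox.
have rAX := related_act _ _ rX; have rAY := related_act _ _ rY.
rewrite (IHm _ _ _ _ rX rY)// (IHm _ _ _ _ rAX rAY)// (IHm _ _ _ _ rX rAY)//.
rewrite (IHm _ _ _ _ rAX rY)// !(derive_jac _ (dT x Ox)) -mulmxDr.
by rewrite -!(derive_jac _ (dT x Ox)) !AA'// !(derive_jac _ (dT x Ox)) -mulmxDr -mulmxBr.
Qed.

(** * The filtration of matrices by diagonals *)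

Definition band (R : realType) (n k : nat) (B : 'M[R]_n) : Prop :=
  forall i j : 'I_n, (j < i + k)%N -> B i j = 0.

Lemma band_leq (R : realType) (n k l : nat) (B : 'M[R]_n) :
  (k <= l)%N -> band l B -> band k B.
Proof.
by move=> kl Bl i j ij; apply: Bl; apply: leq_trans ij _; rewrite leq_add2l.
Qed.

Lemma band_mulmx (R : realType) (n k l : nat) (B C : 'M[R]_n) :
  band k B -> band l C -> band (k + l) (B *m C).
Proof.
move=> Bk Cl i j ij; rewrite mxE big1// => h _.
have [hi|ih] := ltnP h (i + k)%N; first by rewrite Bk ?mul0r.
by rewrite Cl ?mulr0//; apply: leq_trans ij _; rewrite addnA leq_add2r.
Qed.

Lemma band_sub (R : realType) (n k : nat) (B C : 'M[R]_n) :
  band k B -> band k C -> band k (B - C).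
Proof. by move=> Bk Ck i j ij; rewrite !mxE Bk ?Ck ?subr0. Qed.

Lemma band_opp (R : realType) (n k : nat) (B : 'M[R]_n) :
  band k B -> band k (- B).
Proof. by move=> Bk i j ij; rewrite mxE Bk ?oppr0. Qed.

Lemma band_exp (R : realType) (n k : nat) (B : 'M[R]_n) :
  band 1 B -> band k (B ^+ k).
Proof.
move=> B1; elim: k => [|k IHk]; last by rewrite exprS; exact: (band_mulmx B1).
by move=> i j; rewrite addn0 expr0 mxE -val_eqE => /gtn_eqF->.
Qed.

Lemma band_derive (R : realType) (n k : nat) (U : normedModType R)
    (A : U -> 'M[R]_n) (x v : U) :
  differentiable A x -> (\forall y \near x, band k (A y)) ->
  band k ('D_v A x).
Proof.
move=> dA Ak i j ij; rewrite derive_entry//.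
rewrite (@near_eq_derive _ _ _ _ (cst 0)) ?derive_cst//.
by apply: filterS Ak => y; exact.
Qed.

(** * Torsions of a strictly triangular operator *)

(** Matrix products become opaque, so that only an identity between sums is left
    to check entrywise. *)
Ltac mx_zmod :=
  repeat match goal with |- context [?B *m ?C] => move: (B *m C) => ? end;
  apply/matrixP => ? ?; rewrite !mxE; ring.

(** The terms A^2 D_X Y, A D_{AX} Y and A D_X (A Y) cancel up to derivatives
    of A, which is why the first torsion is already tensorial. *)
Lemma torsion1E (R : realType) (n : nat) (A : 'cV[R]_n -> 'M[R]_n)
    (X Y : 'cV[R]_n -> 'cV[R]_n) (x : 'cV[R]_n) :
  differentiable A x -> differentiable X x -> differentiable Y x ->
  torsion A 1 X Y x =
    ('D_(A x *m X x) A x - A x *m 'D_(X x) A x) *m Y x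
    - ('D_(A x *m Y x) A x - A x *m 'D_(Y x) A x) *m X x.
Proof.
move=> dA dX dY.
(* e1, e2, e3, e4 stand for D_{AX} (A Y), D_{AY} (A X), D_X (A Y), D_Y (A X) and
   p, q, r, s for D_X Y, D_Y X, D_{AX} Y, D_{AY} X *)
have expand (a b1 b2 b3 b4 : 'M[R]_n) (u v p q r s e1 e2 e3 e4 : 'cV[R]_n) :
    e1 = b1 *m v + a *m r -> e2 = b2 *m u + a *m s ->
    e3 = b3 *m v + a *m p -> e4 = b4 *m u + a *m q ->
    a *m (a *m (p - q)) + (e1 - e2) - a *m (e3 - s + (r - e4)) =
    (b1 - a *m b3) *m v - (b2 - a *m b4) *m u.
  move=> -> -> -> ->; rewrite !(mulmxDl, mulmxDr, mulmxN, mulNmx) -!mulmxA.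
  by mx_zmod.
by apply: expand; exact: derive_mulmx.
Qed.

(** The right-hand side is Phi(X, Y) - Phi(Y, X) with
    Phi(X, Y) = g(A^(m+1) X) Y + r(X) Y.  With [B, A] = B A - A B, which raises
    the level of B by one, the step from order k to order k + 1 is
      g'(u) = [g(u), A],
      r'(u) = [r(A u), A] - A [g(A^k u), A] - A [r(u), A].
    The one contribution to Phi that does not gain two levels is
    g'(A^(k+1) X) Y, hence the separate leading term. *)
Lemma torsion_normal_form (R : realType) (n : nat)
    (A : 'cV[R]_n -> 'M[R]_n) (x : 'cV[R]_n) :
  differentiable A x -> (\forall y \near x, band 1 (A y)) ->
  forall m, exists g r : 'cV[R]_n -> 'M[R]_n,
  [/\ forall a u, g (a *: u) = a *: g u, forall u, band m.+1 (g u),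
      forall u, band m.+2 (r u) &
      forall X Y, differentiable X x -> differentiable Y x ->
      torsion A m.+1 X Y x =
        (g (A x ^+ m.+1 *m X x) + r (X x)) *m Y x
        - (g (A x ^+ m.+1 *m Y x) + r (Y x)) *m X x].
Proof.
move=> dA An1; have A1 : band 1 (A x) by exact: nbhs_singleton An1.
elim=> [|m [g [r [gZ gB rB tauE]]]].
  have B1 u := band_derive u dA An1.
  exists (fun u => 'D_u A x), (fun u => - (A x *m 'D_u A x)); split => //.
  - by move=> a u; rewrite !deriveE// linearZ.
  - by move=> u; apply: band_opp; exact: (band_mulmx A1).
  by move=> X Y dX dY; rewrite torsion1E// expr1.
exists (fun u => g u *m A x - A x *m g u), (fun u =>
  r (A x *m u) *m A x - A x *m r (A x *m u)
  - A x *m (g (A x ^+ m.+1 *m u) *m A x - A x *m g (A x ^+ m.+1 *m u))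
  - A x *m (r u *m A x - A x *m r u)); split.
- by move=> a u; rewrite gZ -scalemxAr -scalemxAl -scalerBr.
- move=> u; apply: band_sub; last exact: (band_mulmx A1).
  by rewrite -addn1; exact: (band_mulmx (gB u)).
- have comm k (B : 'M[R]_n) : band k B -> band k.+1 (B *m A x - A x *m B).
    move=> Bk; apply: band_sub; last exact: (band_mulmx A1).
    by rewrite -addn1; exact: band_mulmx.
  move=> u; apply: band_sub; last first.
    by apply: (band_leq (leqnSn _)); apply: (band_mulmx A1); exact/comm/rB.
  by apply: band_sub; [exact/comm/rB|apply: (band_mulmx A1); exact/comm/gB].
move=> X Y dX dY; have dAX := differentiable_mulmx dA dX.
have dAY := differentiable_mulmx dA dY.
rewrite -[LHS]/(
  A x *m (A x *m torsion A m.+1 X Y x)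
  + torsion A m.+1 (fun y => A y *m X y) (fun y => A y *m Y y) x
  - A x *m (torsion A m.+1 X (fun y => A y *m Y y) x
            + torsion A m.+1 (fun y => A y *m X y) Y x)).
rewrite (tauE X Y)// (tauE _ _ dAX dAY) (tauE X _ dX dAY) (tauE _ Y dAX dY).
have powS u : A x ^+ m.+1 *m (A x *m u) = A x ^+ m.+2 *m u.
  by rewrite mulmxA (exprSr _ m.+1).
rewrite !powS.
move: (g (A x ^+ m.+2 *m X x)) (g (A x ^+ m.+2 *m Y x)) => gX2 gY2.
move: (g (A x ^+ m.+1 *m X x)) (g (A x ^+ m.+1 *m Y x)) => gX1 gY1.
rewrite !(mulmxDl, mulmxDr, mulmxN, mulNmx) -!mulmxA.
by mx_zmod.
Qed.

(** A square matrix of size k + 1 and level k is supported by its upper right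
    corner. *)
Lemma band_corner_mul (R : realType) (k : nat) (B : 'M[R]_k.+1) (u : 'cV_k.+1) :
  band k B -> B *m u = (B ord0 ord_max * u ord_max 0) *: delta_mx ord0 0.
Proof.
move=> Bk; apply/colP => i; rewrite !mxE eqxx andbT.
have [->|i0] := eqVneq i ord0; last first.
  rewrite mulr0 big1// => j _; rewrite Bk ?mul0r//.
  have := ltn_ord j; move: i0; rewrite -val_eqE /=; lia.
rewrite mulr1 (bigD1 ord_max)//= big1 ?addr0// => j jk.
rewrite Bk ?mul0r// add0n; have := ltn_ord j; move: jk; rewrite -val_eqE /=; lia.
Qed.

Lemma triangular_torsion_eq0 (R : realType) (n : nat) (n1 : (2 <= n)%N)
    (A : 'cV[R]_n -> 'M[R]_n) (X Y : 'cV[R]_n -> 'cV[R]_n) (x : 'cV[R]_n) :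
  differentiable A x -> (\forall y \near x, band 1 (A y)) ->
  differentiable X x -> differentiable Y x -> torsion A n.-1 X Y x = 0.
Proof.
case: n n1 A X Y x => [|[|k]]// _ A X Y x dA An1 dX dY.
have A1 : band 1 (A x) by exact: nbhs_singleton An1.
have [g [r [gZ gB rB tauE]]] := torsion_normal_form dA An1 k.
rewrite [LHS](tauE X Y dX dY).
(* r has level k + 2, which is also the size of the matrices *)
have r0 u : r u = 0.
  by apply/matrixP => i j; rewrite mxE rB//; have := ltn_ord j; lia.
rewrite !r0 !addr0 !(band_corner_mul _ (@band_exp _ _ k.+1 _ A1)) !gZ.
rewrite -!scalemxAl !(band_corner_mul _ (gB _)) !scalerA.
by apply/eqP; rewrite subr_eq0; apply/eqP; congr (_ *: _); ring.
Qed.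

(** * From components in a chart to the manifold *)

Lemma Ck_on_subset (R : realType) (n : nat) (V : normedModType R) (k : nat)
    (O O' : set 'cV[R]_n) (f : 'cV[R]_n -> V) :
  O' `<=` O -> Ck_on k O f -> Ck_on k O' f.
Proof.
move=> sO; elim: k f => [|k IHk] f /=; first by move=> fc x /sO; exact: fc.
by move=> [df pf]; split=> [x /sO|i]; [exact: df|exact: IHk].
Qed.

(** All operations on component families are local to one chart, so a
    computation on the manifold may be read in coordinates. *)
Lemma torsion_in_chart (R : realType) (n : nat) (M : manifold R n)
    (A : tcomp M) (c : chart R n M) (q : M) :
  chart_dom c q -> forall m X Y,
  nijenhuis_torsion A m X Y c q =
  torsion (fun x => A c (chart_inv c x)) m (fun x => X c (chart_inv c x))
          (fun x => Y c (chart_inv c x)) (c q).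
Proof.
move=> cq; elim=> [|m IHm] X Y /=.
  by rewrite /lie_bracket /bracket chart_mapK.
rewrite chart_mapK// -(IHm X Y) -(IHm (t11_act A X) (t11_act A Y)).
by rewrite -(IHm X (t11_act A Y)) -(IHm (t11_act A X) Y).
Qed.

Lemma open_chart_image (R : realType) (n : nat) (M : manifold R n)
    (c : chart R n M) (V : set M) :
  open V -> V `<=` chart_dom c -> open (c @` V).
Proof.
move=> oV Vc.
have -> : c @` V = c @` chart_dom c `&` [set x | V (chart_inv c x)].
  apply/seteqP; split=> [_ [p Vp <-]|x [[p cp <-]]] /=.
    by rewrite chart_mapK; [split => //; exists p|]; auto.
  by rewrite chart_mapK// => Vp; exists p.
rewrite openE => x [cx Vx]; rewrite /interior.
apply: filterI; first by apply: open_nbhs_nbhs; split=> //; exact: chart_img_open.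
by apply: (chart_inv_continuous cx); exact: open_nbhs_nbhs.
Qed.

Lemma triangular_band (R : realType) (n : nat) (M : manifold R n)
    (A : tensor11 M) (c : chart R n M) (q : M) :
  triangular_in A c -> chart_dom c q -> band 1 (t11_comp A c q).
Proof.
move=> [a [_ a0 AE]] cq i j; rewrite addn1 ltnS => ji.
rewrite AE// summxE big1// => k _; rewrite summxE big1// => l _; rewrite !mxE.
have [ik|_] := eqVneq i k; have [jl|_] := eqVneq j l; rewrite ?mulr0//.
by rewrite -ik -jl a0 ?mul0r.
Qed.

Theorem corollary27 (R : realType) (n : nat) (hn : (2 <= n)%N)
    (M : manifold R n) (A : tensor11 M) (hA : nilcyclic A)
    (c : chart R n M) (hc : atlas c) (htri : triangular_in A c)
    (W : set M) (hW : open W) (X Y : vector_field W)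
    (p : M) (hpW : W p) (hpc : chart_dom c p) :
  vanishes_at (nijenhuis_torsion A n.-1 X Y) p.
Proof.
move=> d hd hpd.
pose V := W `&` chart_dom c `&` chart_dom d.
pose O := c @` V; pose T := transition c d.
have oV : open V by do 2?apply: openI => //; exact: chart_dom_open.
have oO : open O by apply: open_chart_image => // q [[]].
have Tc q : chart_dom c q -> T (c q) = d q.
  by move=> cq; rewrite /T /transition chart_mapK.
have C2T : Ck_on 2 O T.
  have [TS _] := atlas_compatible hc hd.
  by apply: (Ck_on_subset _ (TS 2%N)) => _ [q [[Wq cq] dq] <-]; exists q.
have field_differentiable (e : chart R n M) (Z : vector_field W) q :
    atlas e -> W q -> chart_dom e q ->
    differentiable (fun x => vf_comp Z e (chart_inv e x)) (e q).
  move=> he Wq eq_; have [dZ _] := vf_smooth Z he 1%N.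
  by apply: dZ; exists q.
have tensor_differentiable (e : chart R n M) q : atlas e -> chart_dom e q ->
    differentiable (fun x => t11_comp A e (chart_inv e x)) (e q).
  move=> he eq_; have [dA _] := t11_smooth A he 1%N.
  by apply: dA; exists q.
have field_related (Z : vector_field W) :
    related O T (fun x => vf_comp Z c (chart_inv c x))
                (fun x => vf_comp Z d (chart_inv d x)).
  split=> _ [q [[Wq cq] dq] <-].
  - exact: field_differentiable.
  - by rewrite Tc//; exact: field_differentiable.
  - by rewrite Tc// !chart_mapK//; exact: vf_transform.
rewrite (torsion_in_chart A hpd) -(Tc p hpc).
rewrite (torsion_related (A := fun x => t11_comp A c (chart_inv c x)) oO C2T _ _ _
  n.-1 (field_related X) (field_related Y)); last by exists p.
- rewrite triangular_torsion_eq0 ?derive0//.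
  + exact: tensor_differentiable.
  (* triangularity must hold around c p, because A is differentiated there *)
  + have : \forall x \near c p, (c @` chart_dom c) x.
      by apply: open_nbhs_nbhs; split; [exact: chart_img_open|exists p].
    apply: filterS => _ [q cq <-]; rewrite chart_mapK//.
    exact: triangular_band.
  + exact: field_differentiable.
  + exact: field_differentiable.
- by move=> _ [q [[Wq cq] dq] <-]; exact: tensor_differentiable.
- by move=> _ [q [[Wq cq] dq] <-]; rewrite Tc//; exact: tensor_differentiable.
- move=> _ [q [[Wq cq] dq] <-] v; rewrite Tc// !chart_mapK//.
  exact: t11_transform.
Qed.
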